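(* Let $F$ be a field in which $2$ is invertible, and let $(V,B)$ be a formed space over $F$ of dimension $3$. (a) The bilinear form $B$ on $V$ is degenerate if and only if the norm $N$ on the quadratic algebra $K(V,B)$ is degenerate. (b) The $8$-dimensional algebra $K(V,B)$ is simple if and only if the bilinear form $B$ is nondegenerate.
   Context: Algebras over $F$ are unital but not necessarily associative. A formed space $(V,B)$ is a finite-dimensional $F$-vector space $V$ with a symmetric bilinear form $B$. An algebra is alternative if $x(xy)=(xx)y$ and $y(xx)=(yx)x$ for all elements $x,y$. $\mathrm{Alt}[V]$ denotes the free (unital) alternative $F$-algebra over $V$: it is alternative, contains $V$ as a subspace and $F=F1$, and each linear map from $V$ to an alternative $F$-algebra extends uniquely to an $F$-algebra homomorphism on $\mathrm{Alt}[V]$. The Kingdon algebra is $K(V,B)=\mathrm{Alt}[V]/I_B$, where $I_B$ is the two-sided ideal generated by all elements $uv+vu-B(u,v)\cdot 1$ and $(uv)w-w(vu)$ with $u,v,w\in V$. An $F$-algebra $A$, in which the subalgebra $F[a]$ is commutative for each $a\in A$, is symmetric quadratic if it has an involutory ($F$-linear) anti-automorphism $a\mapsto a^*$ (conjugation), restricting to an automorphism of $F[a]$ for each $a\in A$, such that $T(a)=a+a^*\in F$ and $N(a)=aa^*\in F$, with $(X-a)(X-a^* )=X^2-T(a)X+N(a)$ in $F[X]$, $T(1)=2$ and $N(1)=1$. The map $N\colon A\to F$ is the norm. For $\dim V=3$, the algebra $K(V,B)$ is $8$-dimensional and symmetric quadratic, and $N$ denotes its norm (a quadratic form). The norm is degenerate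 if the symmetric bilinear form $N(x+y)-N(x)-N(y)$ is degenerate. *)

(* Defs.v *)
From HB Require Import structures.
From mathcomp Require Import all_boot all_order all_algebra.
From mathcomp Require Import boolp classical_sets.

Set Implicit Arguments.
Unset Strict Implicit.
Unset Printing Implicit Defensive.

Import GRing.Theory.
Local Open Scope ring_scope.
Local Open Scope classical_set_scope.
Local Open Scope quotient_scope.

(* Unital, not necessarily associative F-algebras: the additive structure is
   the one of lmodType (ring_scope), the product and the unit are the ones of
   umagmaType (group_scope, [(x * y)%g] and [1%g]). *)
HB.mixin Record LmoduleUMagma_isNAlgebra (F : fieldType) A
    of GRing.Lmodule F A & UMagma A := {
  nmulDl : forall x y z : A, ((x + y)%R * z)%g = (x * z)%g + (y * z)%g;
  nmulDr : forall x y z : A, (x * (y + z)%R)%g = (x * y)%g + (x * z)%g;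
  nmulZl : forall (c : F) (x y : A), ((c *: x)%R * y)%g = c *: (x * y)%g;
  nmulZr : forall (c : F) (x y : A), (x * (c *: y)%R)%g = c *: (x * y)%g
}.

#[short(type="nalgType")]
HB.structure Definition NAlgebra (F : fieldType) :=
  {A of LmoduleUMagma_isNAlgebra F A & GRing.Lmodule F A & UMagma A}.

Section NAlgebraDefs.
Variables (F : fieldType) (A : nalgType F).
Implicit Types (x y : A) (S I : set A).

Definition alternative :=
  (forall x y, (x * (x * y) = (x * x) * y)%g) /\
  (forall x y, (y * (x * x) = (y * x) * x)%g).

Definition nalg_hom (A' : nalgType F) (f : A -> A') :=
  [/\ linear f, f 1%g = 1%g & forall x y, f (x * y)%g = (f x * f y)%g].

Definition two_sided_ideal I :=
  [/\ I 0, forall x y, I x -> I y -> I (x + y),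
      forall (c : F) x, I x -> I (c *: x),
      forall x y, I y -> I (x * y)%g & forall x y, I x -> I (x * y)%g].

Definition simple_alg :=
  (1%g : A) <> 0 /\ forall I, two_sided_ideal I -> I = [set 0] \/ I = setT.

Definition has_dim (n : nat) :=
  exists f : A -> 'rV[F]_n, linear f /\ bijective f.

Definition subalgebra S :=
  [/\ S 1%g, forall x y, S x -> S y -> S (x + y),
      forall (c : F) x, S x -> S (c *: x)
    & forall x y, S x -> S y -> S (x * y)%g].

(* F[a] *)
Definition gen_subalg (a : A) : set A :=
  [set x | forall S, subalgebra S -> S a -> S x].

(* [star] is the conjugation, [T] the trace and [N] the norm; an element of F
   is seen in A as its multiple of 1, whence [sq_F1]. As X is central,
   the identity (X - a)(X - a^* ) = X^2 - T(a) X + N(a) is, coefficient by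
   coefficient, [sq_trace] and [sq_norm]. *)
Record symmetric_quadratic (star : A -> A) (T N : A -> F) : Prop :=
  SymmetricQuadratic {
  sq_F1 : (1%g : A) <> 0;
  sq_comm : forall a x y,
    gen_subalg a x -> gen_subalg a y -> (x * y = y * x)%g;
  sq_linear : linear star;
  sq_invol : involutive star;
  sq_anti : forall x y, star (x * y)%g = (star y * star x)%g;
  sq_aut_im : forall a, star @` gen_subalg a = gen_subalg a;
  sq_aut_mul : forall a x y, gen_subalg a x -> gen_subalg a y ->
    star (x * y)%g = (star x * star y)%g;
  sq_trace : forall a, a + star a = T a *: 1%g;
  sq_norm : forall a, (a * star a)%g = N a *: 1%g;
  sq_trace1 : T 1%g = 2%:R;
  sq_norm1 : N 1%g = 1
}.

End NAlgebraDefs.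

Arguments simple_alg {F} A.
Arguments alternative {F} A.
Arguments has_dim {F} A n.
Arguments symmetric_quadratic {F} A star T N.

Definition polar (F : fieldType) (U : lmodType F) (q : U -> F) (x y : U) : F :=
  q (x + y) - q x - q y.

(* MathComp's [nondegenerate] needs a vectType, hence this variant for the
   norm of an algebra that is not known beforehand to be finite-dimensional;
   [degenerate_formP] relates the two. *)
Definition degenerate_form (F : fieldType) (U : lmodType F) (f : U -> U -> F) :=
  exists2 x : U, x <> 0 & forall y : U, f x y = 0.

Lemma degenerate_formP (F : fieldType) (V : vectType F) (B : {symmetric V}) :
  ~~ nondegenerate B <-> degenerate_form B.
Proof.
split=> [ndB|[x x0 Bx]].
  have [x /mem_orthovP Bx x0] : exists2 x, x \in orthov B fullv & x != 0.
    by exists (vpick (orthov B fullv)); rewrite ?memv_pick ?vpick0.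
  by exists x => [|y]; [apply/eqP | rewrite Bx ?memvf].
apply/negP => /eqP radB0; apply: x0; apply/eqP.
by rewrite -memv0 -radB0; apply/mem_orthovP => y _; apply: Bx.
Qed.

Section QuotientAlgebra.
Variables (F : fieldType) (A : nalgType F) (S : set A).

Definition ideal_gen : {pred A} :=
  [pred x | `[< forall I, two_sided_ideal I -> S `<=` I -> I x >]].

Lemma ideal_genP x :
  reflect (forall I, two_sided_ideal I -> S `<=` I -> I x) (x \in ideal_gen).
Proof. exact: asboolP. Qed.

Lemma ideal_gen_ideal : two_sided_ideal [set x | x \in ideal_gen].
Proof.
split=> [|x y|c x|x y|x y] /=.
- by apply/ideal_genP => I [].
- move=> /ideal_genP hx /ideal_genP hy; apply/ideal_genP => I idI sI.
  by case: (idI) => _ h _ _ _; apply: h; [apply: hx|apply: hy].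
- move=> /ideal_genP hx; apply/ideal_genP => I idI sI.
  by case: (idI) => _ _ h _ _; apply: h; apply: hx.
- move=> /ideal_genP hx; apply/ideal_genP => I idI sI.
  by case: (idI) => _ _ _ h _; apply: h; apply: hx.
- move=> /ideal_genP hx; apply/ideal_genP => I idI sI.
  by case: (idI) => _ _ _ _ h; apply: h; apply: hx.
Qed.

Lemma ideal_gen_zmod_closed : zmod_closed ideal_gen.
Proof.
have [h0 hD hZ _ _] := ideal_gen_ideal.
split=> // x y hx hy; apply: hD => //.
by rewrite -scaleN1r; apply: hZ.
Qed.

HB.instance Definition _ := GRing.isZmodClosed.Build A ideal_gen
  ideal_gen_zmod_closed.

Definition quot_alg : Type := {ideal_quot ideal_gen}.
HB.instance Definition _ := GRing.Zmodule.on quot_alg.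

Definition quot_pi : A -> quot_alg := \pi_({ideal_quot ideal_gen}).

Lemma quot_piP x y : quot_pi x = quot_pi y <-> x - y \in ideal_gen.
Proof.
rewrite Quotient.idealrBE; split=> [h|/eqP//].
exact/eqP.
Qed.

Lemma quot_piD : {morph quot_pi : x y / x + y}.
Proof. by move=> x y; rewrite /quot_pi Quotient.pi_add. Qed.

Lemma quot_ind (P : quot_alg -> Prop) :
  (forall x, P (quot_pi x)) -> forall x, P x.
Proof. by move=> h; apply: quotW => x; apply: h. Qed.

Definition quot_scale (c : F) (x : quot_alg) : quot_alg :=
  quot_pi (c *: repr x).
Definition quot_mul (x y : quot_alg) : quot_alg :=
  quot_pi (repr x * repr y)%g.

Lemma reprB x : repr (quot_pi x) - x \in ideal_gen.
Proof. by apply/quot_piP; rewrite /quot_pi reprK. Qed.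

Lemma quot_piZ c x : quot_scale c (quot_pi x) = quot_pi (c *: x).
Proof.
apply/quot_piP; rewrite -scalerBr.
by have [_ _ h _ _] := ideal_gen_ideal; apply/h/reprB.
Qed.

Lemma quot_piM x y : quot_mul (quot_pi x) (quot_pi y) = quot_pi (x * y)%g.
Proof.
apply/quot_piP; set x' := repr _; set y' := repr _.
have -> : (x' * y')%g - (x * y)%g = ((x' - x)%R * y')%g + (x * (y' - y)%R)%g.
  rewrite nmulDl nmulDr -!scaleN1r nmulZl nmulZr !scaleN1r.
  by rewrite addrA subrK.
have [_ hD _ hr hl] := ideal_gen_ideal.
by apply: hD; [apply: hl; apply: reprB|apply: hr; apply: reprB].
Qed.

Lemma quot_scaleA a b v :
  quot_scale a (quot_scale b v) = quot_scale (a * b) v.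
Proof. by elim/quot_ind: v => x; rewrite !quot_piZ scalerA. Qed.
Lemma quot_scale1 : left_id 1 quot_scale.
Proof. by elim/quot_ind=> x; rewrite quot_piZ scale1r. Qed.
Lemma quot_scaleDr : right_distributive quot_scale +%R.
Proof.
by move=> c; elim/quot_ind=> x; elim/quot_ind=> y;
   rewrite -quot_piD !quot_piZ scalerDr quot_piD.
Qed.
Lemma quot_scaleDl v : {morph quot_scale^~ v : a b / a + b}.
Proof.
by move=> a b; elim/quot_ind: v => x; rewrite !quot_piZ scalerDl quot_piD.
Qed.

HB.instance Definition _ := GRing.Zmodule_isLmodule.Build F quot_alg
  quot_scaleA quot_scale1 quot_scaleDr quot_scaleDl.

Lemma quot_mul1 : left_id (quot_pi 1%g) quot_mul.
Proof. by elim/quot_ind=> x; rewrite quot_piM mul1g. Qed.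
Lemma quot_1mul : right_id (quot_pi 1%g) quot_mul.
Proof. by elim/quot_ind=> x; rewrite quot_piM mulg1. Qed.

HB.instance Definition _ := hasMul.Build quot_alg quot_mul.
HB.instance Definition _ := Magma_isUMagma.Build quot_alg quot_mul1 quot_1mul.

Fact quot_nmulDl (x y z : quot_alg) :
  ((x + y)%R * z)%g = (x * z)%g + (y * z)%g.
Proof.
elim/quot_ind: x => x; elim/quot_ind: y => y; elim/quot_ind: z => z.
by rewrite -quot_piD [LHS]quot_piM nmulDl quot_piD -!quot_piM.
Qed.
Fact quot_nmulDr (x y z : quot_alg) :
  (x * (y + z)%R)%g = (x * y)%g + (x * z)%g.
Proof.
elim/quot_ind: x => x; elim/quot_ind: y => y; elim/quot_ind: z => z.
by rewrite -quot_piD [LHS]quot_piM nmulDr quot_piD -!quot_piM.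
Qed.
Fact quot_nmulZl c (x y : quot_alg) : ((c *: x)%R * y)%g = c *: (x * y)%g.
Proof.
elim/quot_ind: x => x; elim/quot_ind: y => y.
rewrite [c *: _]quot_piZ [LHS]quot_piM nmulZl -quot_piZ.
by congr (quot_scale _ _); rewrite -quot_piM.
Qed.
Fact quot_nmulZr c (x y : quot_alg) : (x * (c *: y)%R)%g = c *: (x * y)%g.
Proof.
elim/quot_ind: x => x; elim/quot_ind: y => y.
rewrite [c *: _]quot_piZ [LHS]quot_piM nmulZr -quot_piZ.
by congr (quot_scale _ _); rewrite -quot_piM.
Qed.

HB.instance Definition _ := LmoduleUMagma_isNAlgebra.Build F quot_alg
  quot_nmulDl quot_nmulDr quot_nmulZl quot_nmulZr.

Lemma quot_pi_hom : nalg_hom quot_pi.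
Proof.
by split=> [c x y| |x y] //; rewrite -?quot_piM// quot_piD -quot_piZ.
Qed.

End QuotientAlgebra.

Section FreeAlternative.
Variables (F : fieldType) (V : lmodType F).

Inductive alt_term : Type :=
  | TVar of V
  | TZero
  | TOne
  | TAdd of alt_term & alt_term
  | TScale of F & alt_term
  | TMul of alt_term & alt_term.

(* Alt[V] is the quotient of the terms by the least congruence making them a
   unital alternative algebra in which [TVar] is linear. *)
Inductive alt_eq : alt_term -> alt_term -> Prop :=
  | AErefl t : alt_eq t t
  | AEsym s t : alt_eq s t -> alt_eq t s
  | AEtrans s t u : alt_eq s t -> alt_eq t u -> alt_eq s u
  | AEadd s s' t t' :
      alt_eq s s' -> alt_eq t t' -> alt_eq (TAdd s t) (TAdd s' t')
  | AEscale c t t' : alt_eq t t' -> alt_eq (TScale c t) (TScale c t')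
  | AEmul s s' t t' :
      alt_eq s s' -> alt_eq t t' -> alt_eq (TMul s t) (TMul s' t')
  | AEaddA s t u : alt_eq (TAdd s (TAdd t u)) (TAdd (TAdd s t) u)
  | AEaddC s t : alt_eq (TAdd s t) (TAdd t s)
  | AEadd0 t : alt_eq (TAdd TZero t) t
  | AEaddN t : alt_eq (TAdd (TScale (-1) t) t) TZero
  | AEscaleA a b t : alt_eq (TScale a (TScale b t)) (TScale (a * b) t)
  | AEscale1 t : alt_eq (TScale 1 t) t
  | AEscaleDr c s t :
      alt_eq (TScale c (TAdd s t)) (TAdd (TScale c s) (TScale c t))
  | AEscaleDl a b t :
      alt_eq (TScale (a + b) t) (TAdd (TScale a t) (TScale b t))
  | AEmulDl s t u : alt_eq (TMul (TAdd s t) u) (TAdd (TMul s u) (TMul t u))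
  | AEmulDr s t u : alt_eq (TMul s (TAdd t u)) (TAdd (TMul s t) (TMul s u))
  | AEmulZl c s t : alt_eq (TMul (TScale c s) t) (TScale c (TMul s t))
  | AEmulZr c s t : alt_eq (TMul s (TScale c t)) (TScale c (TMul s t))
  | AEmul1l t : alt_eq (TMul TOne t) t
  | AEmul1r t : alt_eq (TMul t TOne) t
  | AEvar c u v :
      alt_eq (TVar (c *: u + v)) (TAdd (TScale c (TVar u)) (TVar v))
  | AEaltl s t : alt_eq (TMul s (TMul s t)) (TMul (TMul s s) t)
  | AEaltr s t : alt_eq (TMul t (TMul s s)) (TMul (TMul t s) s).

Definition alt_eqb (s t : {classic alt_term}) : bool := `[< alt_eq s t >].

Lemma alt_eqb_equiv : equiv_class_of alt_eqb.
Proof.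
split=> [t|s t|t s u]; first exact/asboolP/AErefl.
  by apply/asboolP/asboolP => /AEsym.
by move=> /asboolP h1 /asboolP h2; apply/asboolP/(AEtrans h1 h2).
Qed.

Canonical alt_eqb_rel := EquivRelPack alt_eqb_equiv.

Definition alt_alg : Type := {eq_quot alt_eqb}.
HB.instance Definition _ := Choice.on alt_alg.

Definition alt_pi (t : alt_term) : alt_alg := \pi_({eq_quot alt_eqb}) t.

Lemma alt_piP s t : alt_pi s = alt_pi t <-> alt_eq s t.
Proof.
split=> [/eqmodP/asboolP//|h].
by apply/eqmodP/asboolP.
Qed.

Lemma alt_ind (P : alt_alg -> Prop) :
  (forall t, P (alt_pi t)) -> forall x, P x.
Proof. by move=> h; apply: quotW => t; apply: h. Qed.

Definition alt_repr (x : alt_alg) : alt_term := repr x.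

Lemma alt_reprP t : alt_eq (alt_repr (alt_pi t)) t.
Proof. by apply/alt_piP; rewrite /alt_pi /alt_repr reprK. Qed.

Definition alt_add x y := alt_pi (TAdd (alt_repr x) (alt_repr y)).
Definition alt_scale c x := alt_pi (TScale c (alt_repr x)).
Definition alt_mul x y := alt_pi (TMul (alt_repr x) (alt_repr y)).

Lemma alt_piD s t : alt_add (alt_pi s) (alt_pi t) = alt_pi (TAdd s t).
Proof. by apply/alt_piP/AEadd; apply: alt_reprP. Qed.
Lemma alt_piZ c t : alt_scale c (alt_pi t) = alt_pi (TScale c t).
Proof. by apply/alt_piP/AEscale; apply: alt_reprP. Qed.
Lemma alt_piM s t : alt_mul (alt_pi s) (alt_pi t) = alt_pi (TMul s t).
Proof. by apply/alt_piP/AEmul; apply: alt_reprP. Qed.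

Let altE := (alt_piD, alt_piZ, alt_piM).

Lemma alt_addA : associative alt_add.
Proof.
by do 3!elim/alt_ind=> ?; rewrite !altE; apply/alt_piP; constructor.
Qed.
Lemma alt_addC : commutative alt_add.
Proof.
by do 2!elim/alt_ind=> ?; rewrite !altE; apply/alt_piP; constructor.
Qed.
Lemma alt_add0 : left_id (alt_pi TZero) alt_add.
Proof. by elim/alt_ind=> ?; rewrite !altE; apply/alt_piP; constructor. Qed.
Lemma alt_addN : left_inverse (alt_pi TZero) (alt_scale (-1)) alt_add.
Proof. by elim/alt_ind=> ?; rewrite !altE; apply/alt_piP; constructor. Qed.

HB.instance Definition _ := GRing.isZmodule.Build alt_alg
  alt_addA alt_addC alt_add0 alt_addN.

Lemma alt_scaleA a b v : alt_scale a (alt_scale b v) = alt_scale (a * b) v.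
Proof. by elim/alt_ind: v => ?; rewrite !altE; apply/alt_piP; constructor. Qed.
Lemma alt_scale1 : left_id 1 alt_scale.
Proof. by elim/alt_ind=> ?; rewrite !altE; apply/alt_piP; constructor. Qed.
Lemma alt_scaleDr : right_distributive alt_scale +%R.
Proof.
by move=> c; do 2!elim/alt_ind=> ?; rewrite /GRing.add /= !altE;
   apply/alt_piP; constructor.
Qed.
Lemma alt_scaleDl v : {morph alt_scale^~ v : a b / a + b}.
Proof.
move=> a b; elim/alt_ind: v => ?; rewrite !altE.
by rewrite [RHS]alt_piD; apply/alt_piP; constructor.
Qed.

HB.instance Definition _ := GRing.Zmodule_isLmodule.Build F alt_alg
  alt_scaleA alt_scale1 alt_scaleDr alt_scaleDl.

Lemma alt_mul1 : left_id (alt_pi TOne) alt_mul.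
Proof. by elim/alt_ind=> ?; rewrite !altE; apply/alt_piP; constructor. Qed.
Lemma alt_1mul : right_id (alt_pi TOne) alt_mul.
Proof. by elim/alt_ind=> ?; rewrite !altE; apply/alt_piP; constructor. Qed.

HB.instance Definition _ := hasMul.Build alt_alg alt_mul.
HB.instance Definition _ := Magma_isUMagma.Build alt_alg alt_mul1 alt_1mul.

Lemma alt_pi_add s t : alt_pi (TAdd s t) = alt_pi s + alt_pi t.
Proof. by rewrite -alt_piD. Qed.
Lemma alt_pi_scale c t : alt_pi (TScale c t) = c *: alt_pi t.
Proof. by rewrite -alt_piZ. Qed.
Lemma alt_pi_mul s t : alt_pi (TMul s t) = (alt_pi s * alt_pi t)%g.
Proof. by rewrite -alt_piM. Qed.

Fact alt_nmulDl (x y z : alt_alg) : ((x + y)%R * z)%g = (x * z)%g + (y * z)%g.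
Proof.
elim/alt_ind: x => x; elim/alt_ind: y => y; elim/alt_ind: z => z.
by rewrite -!(alt_pi_add, alt_pi_mul); apply/alt_piP; constructor.
Qed.
Fact alt_nmulDr (x y z : alt_alg) : (x * (y + z)%R)%g = (x * y)%g + (x * z)%g.
Proof.
elim/alt_ind: x => x; elim/alt_ind: y => y; elim/alt_ind: z => z.
by rewrite -!(alt_pi_add, alt_pi_mul); apply/alt_piP; constructor.
Qed.
Fact alt_nmulZl c (x y : alt_alg) : ((c *: x)%R * y)%g = c *: (x * y)%g.
Proof.
elim/alt_ind: x => x; elim/alt_ind: y => y.
by rewrite -alt_pi_scale -!alt_pi_mul -alt_pi_scale; apply/alt_piP; constructor.
Qed.
Fact alt_nmulZr c (x y : alt_alg) : (x * (c *: y)%R)%g = c *: (x * y)%g.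
Proof.
elim/alt_ind: x => x; elim/alt_ind: y => y.
by rewrite -alt_pi_scale -!alt_pi_mul -alt_pi_scale; apply/alt_piP; constructor.
Qed.

HB.instance Definition _ := LmoduleUMagma_isNAlgebra.Build F alt_alg
  alt_nmulDl alt_nmulDr alt_nmulZl alt_nmulZr.

Definition alt_in (v : V) : alt_alg := alt_pi (TVar v).

Lemma alt_in_linear : linear alt_in.
Proof. by move=> c u v; rewrite /alt_in -alt_pi_scale -alt_pi_add; apply/alt_piP; constructor. Qed.

Lemma alt_alg_alternative : alternative alt_alg.
Proof.
split; elim/alt_ind=> s; elim/alt_ind=> t.
  rewrite -[(alt_pi s * alt_pi t)%g]alt_pi_mul -[(alt_pi s * alt_pi s)%g]alt_pi_mul.
  by rewrite -!alt_pi_mul; apply/alt_piP; constructor.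
rewrite -[(alt_pi t * alt_pi s)%g]alt_pi_mul -[(alt_pi s * alt_pi s)%g]alt_pi_mul.
rewrite -[LHS]alt_pi_mul -[RHS]alt_pi_mul.
by apply/alt_piP; constructor.
Qed.

Section Universal.
Variables (A : nalgType F) (altA : alternative A) (f : V -> A).
Hypothesis linf : linear f.

Fixpoint alt_eval (t : alt_term) : A :=
  match t with
  | TVar v => f v
  | TZero => 0
  | TOne => 1%g
  | TAdd s t => alt_eval s + alt_eval t
  | TScale c t => c *: alt_eval t
  | TMul s t => (alt_eval s * alt_eval t)%g
  end.

Lemma alt_eval_eq s t : alt_eq s t -> alt_eval s = alt_eval t.
Proof.
case: altA => al ar.
elim=> {s t} //=; try by intros; congruence.
- by move=> *; rewrite addrA.
- by move=> *; rewrite addrC.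
- by move=> *; rewrite add0r.
- by move=> *; rewrite scaleN1r addNr.
- by move=> *; rewrite scalerA.
- by move=> *; rewrite scale1r.
- by move=> *; rewrite scalerDr.
- by move=> *; rewrite scalerDl.
- by move=> *; rewrite nmulDl.
- by move=> *; rewrite nmulDr.
- by move=> *; rewrite nmulZl.
- by move=> *; rewrite nmulZr.
- by move=> *; rewrite mul1g.
- by move=> *; rewrite mulg1.
Qed.

Lemma alt_universal :
  exists! g : alt_alg -> A, nalg_hom g /\ forall v, g (alt_in v) = f v.
Proof.
have evalE t : alt_eval (alt_repr (alt_pi t)) = alt_eval t.
  exact/alt_eval_eq/alt_reprP.
exists (fun x => alt_eval (alt_repr x)); split=> [|g [[gL g1 gM] gf]].
  split=> [|v]; last exact: evalE.
  split=> [c|//|].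
  - elim/alt_ind=> s; elim/alt_ind=> t.
    by rewrite -alt_pi_scale -alt_pi_add !evalE.
  - exact: evalE.
  - by elim/alt_ind=> s; elim/alt_ind=> t; rewrite -alt_pi_mul !evalE.
have g0 : g 0 = 0.
  by have := gL (-1) 0 0; rewrite scaler0 addr0 scaleN1r addNr.
apply/funext; elim/alt_ind=> t; rewrite evalE.
elim: t => [v||| s IHs t IHt|c t IHt|s IHs t IHt] /=.
- by rewrite -gf.
- exact: esym g0.
- exact: esym g1.
- by rewrite IHs IHt alt_pi_add -[alt_pi s]scale1r gL !scale1r.
- by rewrite IHt alt_pi_scale -[c *: alt_pi t]addr0 gL g0 addr0.
- by rewrite IHs IHt alt_pi_mul gM.
Qed.

End Universal.

End FreeAlternative.

Section Kingdon.
Variables (F : fieldType) (V : vectType F) (B : {symmetric V}).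

Let i : V -> alt_alg V := @alt_in F V.

Definition kingdon_rel : set (alt_alg V) :=
  [set x | (exists u v : V, x = (i u * i v)%g + (i v * i u)%g - B u v *: 1%g)
        \/ (exists u v w : V,
              x = ((i u * i v) * i w)%g - (i w * (i v * i u))%g)].

Definition kingdon : nalgType F := quot_alg kingdon_rel.

End Kingdon.

(* Main.v *)
(* Diagonalize B in an orthogonal basis e1, e2, e3 and put a_i = B(e_i, e_i) / 2.
   In K(V, B) the e_i anticommute, e_i^2 = a_i, and e1 e2 anticommutes with e3,
   so that three Cayley-Dickson doublings of F, with parameters a_1, a_2, a_3,
   map homomorphically to K(V, B). Conversely the trace-zero elements
   x e1 + y e2 + z e3 of the resulting octonion algebra satisfy the relations of
   K(V, B), and the two homomorphisms are mutually inverse. On the octonions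
   the norm of a doubling is N(x) - c N(y), hence it is nondegenerate exactly when
   a_1 a_2 a_3 is nonzero, that is, when B is. The norm of a symmetric
   quadratic algebra being unique, this gives (a). For (b), the radical of the
   norm is an ideal, and conversely, when the norm is nondegenerate, taking
   anticommutators with e1 and e2 shows that an ideal not containing 1 lies in
   that radical. *)

Require Import Defs.
From HB Require Import structures.
From mathcomp Require Import all_boot all_order all_algebra.
From mathcomp Require Import boolp classical_sets ring.

Set Implicit Arguments.
Unset Strict Implicit.
Unset Printing Implicit Defensive.

Import GRing.Theory.
Local Open Scope ring_scope.

Local Notation "x ** y" := (x * y)%g (at level 40, left associativity).

(** * Bilinear rules and linearized alternative laws *)

Section NAlgebraTheory.
Variables (F : fieldType) (A : nalgType F).

Lemma nmulNl (x y : A) : (- x) ** y = - (x ** y).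
Proof. by rewrite -scaleN1r nmulZl scaleN1r. Qed.

Lemma nmulNr (x y : A) : x ** (- y) = - (x ** y).
Proof. by rewrite -scaleN1r nmulZr scaleN1r. Qed.

Lemma nmulBl (x y z : A) : (x - y) ** z = x ** z - y ** z.
Proof. by rewrite nmulDl nmulNl. Qed.

Lemma nmulBr (x y z : A) : x ** (y - z) = x ** y - x ** z.
Proof. by rewrite nmulDr nmulNr. Qed.

Lemma nmul0l (x : A) : 0 ** x = 0.
Proof. by rewrite -[0 in LHS](scale0r 1%g) nmulZl scale0r. Qed.

Lemma nmul0r (x : A) : x ** 0 = 0.
Proof. by rewrite -[0 in LHS](scale0r 1%g) nmulZr scale0r. Qed.

Lemma nscale1_inj : (1%g : A) <> 0 -> injective (fun c : F => c *: (1%g : A)).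
Proof.
move=> /eqP n1 c d /eqP; rewrite -subr_eq0 -scalerBl scaler_eq0 (negbTE n1) orbF.
by rewrite subr_eq0 => /eqP.
Qed.

Hypothesis altA : alternative A.

(** Replace x by x + y in x(xz) = (xx)z and cancel the pure terms. *)
Lemma altl_lin (x y z : A) : x ** (y ** z) + y ** (x ** z) = (x ** y + y ** x) ** z.
Proof.
case: altA => al _.
have := al (x + y) z; rewrite !(nmulDl, nmulDr) !al => h.
apply: (addrI (x ** x ** z)); apply: (addIr (y ** y ** z)).
by rewrite -!addrA addrA h !addrA.
Qed.

Lemma altr_lin (x y z : A) : (x ** y) ** z + (x ** z) ** y = x ** (y ** z + z ** y).
Proof.
case: altA => _ ar.
have := ar (y + z) x; rewrite !(nmulDl, nmulDr) !ar => h.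
apply: (addrI (x ** y ** y)); apply: (addIr (x ** z ** z)).
by rewrite addrA -[LHS]addrA addrACA -h !addrA.
Qed.

End NAlgebraTheory.

(** * Linear maps and homomorphisms *)

Section Homs.
Variables (F : fieldType) (A A' A'' : nalgType F).

Lemma linearfD (U W : lmodType F) (f : U -> W) : linear f -> {morph f : x y / x + y}.
Proof. by move=> fL x y; rewrite -[x in LHS]scale1r fL scale1r. Qed.

Lemma linearf0 (U W : lmodType F) (f : U -> W) : linear f -> f 0 = 0.
Proof. by move=> fL; rewrite -[0 in LHS](addNr 0) -scaleN1r fL scaleN1r addNr. Qed.

Lemma linearfZ (U W : lmodType F) (f : U -> W) (c : F) :
  linear f -> {morph f : x / c *: x}.
Proof. by move=> fL x; rewrite -[c *: x in LHS]addr0 fL linearf0 ?addr0. Qed.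

Lemma linearfN (U W : lmodType F) (f : U -> W) : linear f -> {morph f : x / - x}.
Proof. by move=> fL x; rewrite -scaleN1r linearfZ ?scaleN1r. Qed.

Lemma nalg_hom_comp (f : A -> A') (g : A' -> A'') :
  nalg_hom f -> nalg_hom g -> nalg_hom (g \o f).
Proof.
case=> fL f1 fM [gL g1 gM]; split=> [c x y||x y] /=.
- by rewrite fL gL.
- by rewrite f1 g1.
- by rewrite fM gM.
Qed.

End Homs.

(** * A criterion for being symmetric quadratic *)

Section SymmetricQuadratic.
Variables (F : fieldType) (A : nalgType F) (star : A -> A) (T N : A -> F).

(** Conjugation is a -> T(a) - a and fixes 1, so it is an involution and a^2 = T(a) a - N(a). Hence
    F[a] lies in F1 + Fa and is commutative; it is stable under conjugation by the same formula. *)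
Lemma symmetric_quadratic_intro :
    (1%g : A) <> 0 -> linear star -> star 1%g = 1%g ->
    (forall x y, star (x ** y) = star y ** star x) ->
    (forall a, a + star a = T a *: 1%g) -> (forall a, a ** star a = N a *: 1%g) ->
  symmetric_quadratic A star T N.
Proof.
move=> n1 sL s1 sM sT sN; have inj := nscale1_inj n1.
have sE a : star a = T a *: 1%g - a by rewrite -sT addrC addKr.
have sV : involutive star.
  move=> a; rewrite [in LHS](sE a) linearfD // linearfZ // linearfN // s1.
  by rewrite -sT addrK.
have aa a : a ** a = T a *: a - N a *: 1%g.
  by rewrite -sN sE nmulBr nmulZr mulg1 opprB addrC subrK.
have genE (a x : A) : gen_subalg a x -> exists c d, x = c *: 1%g + d *: a.
  pose S (y : A) := exists c d, y = c *: 1%g + d *: a.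
  have SD x1 x2 : S x1 -> S x2 -> S (x1 + x2).
    move=> [c [d ->]] [c' [d' ->]]; exists (c + c'), (d + d').
    by rewrite !scalerDl addrACA.
  have SZ k x1 : S x1 -> S (k *: x1).
    by move=> [c [d ->]]; exists (k * c), (k * d); rewrite scalerDr !scalerA.
  move=> /(_ S); apply; last by exists 0, 1; rewrite scale0r scale1r add0r.
  split=> //=; first by exists 1, 0; rewrite scale0r scale1r addr0.
  move=> _ y [c [d ->]] [c' [d' ->]].
  rewrite nmulDl !nmulZl mul1g; apply: SD; apply: SZ; first by exists c', d'.
  rewrite nmulDr !nmulZr mulg1 aa; exists (- (d' * N a)), (c' + d' * T a).
  by rewrite scalerBr !scalerA scaleNr scalerDl addrA addrC.
have commg (a x y : A) : gen_subalg a x -> gen_subalg a y -> x ** y = y ** x.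
  move=> /genE[c [d ->]] gy.
  rewrite nmulDl nmulDr !nmulZl !nmulZr mul1g mulg1; congr (_ + d *: _).
  case/genE: gy => c' [d' ->].
  by rewrite nmulDl nmulDr !nmulZl !nmulZr mul1g mulg1.
have gen_star (a x : A) : gen_subalg a x -> gen_subalg a (star x).
  move=> gx S sS Sa; case: (sS) => S1 SD SZ _.
  rewrite sE -scaleN1r; apply: SD; last by apply: SZ; apply: gx.
  exact: SZ.
split=> //.
- move=> a; apply/seteqP; split=> [_ [x gx <-]|x gx]; first exact: gen_star.
  by exists (star x); [apply: gen_star|rewrite sV].
- by move=> a x y gx gy; rewrite sM; apply: (commg a); apply: gen_star.
- by apply: inj; rewrite /= -sT s1 scalerDl scale1r.
- by apply: inj; rewrite /= -sN s1 mul1g scale1r.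
Qed.

End SymmetricQuadratic.

(** * Trace, norm and ideals of symmetric quadratic algebras *)

Section SymmetricQuadraticTheory.
Variables (F : fieldType) (A : nalgType F) (star : A -> A) (T N : A -> F).
Hypothesis sqA : symmetric_quadratic A star T N.

Let inj1 := nscale1_inj (sq_F1 sqA).

Lemma sq_star1 : star 1%g = 1%g.
Proof.
apply: (addrI (1%g : A)); rewrite (sq_trace sqA) (sq_trace1 sqA).
by rewrite scaler_nat.
Qed.

Lemma sq_starE (x : A) : star x = T x *: 1%g - x.
Proof. by rewrite -(sq_trace sqA) addrC addKr. Qed.

Lemma sq_mulxx (x : A) : x ** x = T x *: x - N x *: 1%g.
Proof.
by rewrite -(sq_norm sqA) sq_starE nmulBr nmulZr mulg1 opprB addrC subrK.
Qed.

Lemma sq_norml (x : A) : star x ** x = N x *: 1%g.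
Proof. by rewrite sq_starE nmulBl nmulZl mul1g sq_mulxx opprB addrC subrK. Qed.

Lemma sq_traceD : {morph T : x y / x + y}.
Proof.
move=> x y; apply: inj1; rewrite /= scalerDl -!(sq_trace sqA).
by rewrite (linearfD (sq_linear sqA)) addrACA.
Qed.

Lemma sq_traceZ (c : F) (x : A) : T (c *: x) = c * T x.
Proof.
apply: inj1; rewrite /= -scalerA -!(sq_trace sqA).
by rewrite (linearfZ _ (sq_linear sqA)) scalerDr.
Qed.

Lemma sq_polar1 (x y : A) : polar N x y *: 1%g = x ** star y + y ** star x.
Proof.
rewrite /polar !scalerBl -!(sq_norm sqA) (linearfD (sq_linear sqA)).
rewrite nmulDl !nmulDr -addrA -opprD (addrC (y ** star x)) addrACA.
by rewrite [LHS]addrAC subrr add0r.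
Qed.

(** The two terms of [sq_polar1] are conjugate to each other. This makes the radical of N accessible
    through T. *)
Lemma sq_polar (x y : A) : polar N x y = T (x ** star y).
Proof.
apply: inj1; rewrite /= sq_polar1 -(sq_trace sqA).
by rewrite (sq_anti sqA) (sq_invol sqA).
Qed.

(** The polarized quadratic equation; orthogonal elements of trace 0 therefore anticommute. *)
Lemma sq_mulC (x y : A) :
  x ** y + y ** x = T x *: y + T y *: x - polar N x y *: 1%g.
Proof.
rewrite sq_polar1 !sq_starE !nmulBr !nmulZr !mulg1 addrACA -opprD opprB.
by rewrite [X in _ - X]addrC addrCA subrr addr0.
Qed.

(** Expanding the conjugates, both traces times 1 equal xy + yx + T(x) [star y] - T(y) x. *)
Lemma sq_traceC (x y : A) : T (x ** y) = T (y ** x).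
Proof.
apply: inj1; rewrite /= -!(sq_trace sqA) !(sq_anti sqA).
have -> : star y ** star x = T x *: star y - T y *: x + y ** x.
  rewrite [star x]sq_starE nmulBr nmulZr mulg1 [in X in _ - X]sq_starE.
  by rewrite nmulBl nmulZl mul1g opprB addrA addrAC.
have -> : star x ** star y = T x *: star y - T y *: x + x ** y.
  rewrite [star x]sq_starE nmulBl nmulZl mul1g [in X in _ - X]sq_starE.
  by rewrite nmulBr nmulZr mulg1 opprB addrA addrAC.
by rewrite addrCA [RHS]addrCA [y ** x + _]addrC [x ** y + _]addrC.
Qed.

Let ass (x y z : A) := (x ** y) ** z - x ** (y ** z).

(* The associator is alternating and conjugation reverses it up to two signs,
   so it is skew under conjugation and has trace 0. *)
Lemma sq_traceA (x y z : A) : alternative A ->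
  T ((x ** y) ** z) = T (x ** (y ** z)).
Proof.
move=> altA; have starE := sq_starE.
have ass1 u v w : ass (star u) v w = - ass u v w.
  rewrite /ass starE !nmulBl !nmulZl !mul1g.
  by rewrite opprB addrC addrA subrK opprB.
have ass2 u v w : ass u (star v) w = - ass u v w.
  rewrite /ass starE !(nmulBl, nmulBr) !nmulZl !nmulZr !(mul1g, mulg1) nmulZl.
  by rewrite opprB addrC addrA subrK opprB.
have ass3 u v w : ass u v (star w) = - ass u v w.
  rewrite /ass starE !nmulBr !nmulZr !mulg1.
  by rewrite opprB addrC addrA subrK opprB.
have assl u v w : ass u v w = - ass v u w.
  apply/eqP; rewrite -subr_eq0 opprK addrACA -nmulDl -opprD altl_lin // subrr //.
have assr u v w : ass u v w = - ass u w v.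
  apply/eqP; rewrite -subr_eq0 opprK addrACA -opprD -nmulDr altr_lin // subrr //.
have star_ass : star (ass x y z) = - ass x y z.
  have -> : star (ass x y z) = - ass (star z) (star y) (star x).
    rewrite /ass (linearfD (sq_linear sqA)) (linearfN (sq_linear sqA)).
    by rewrite !(sq_anti sqA) opprB addrC.
  by rewrite ass1 ass2 ass3 assl assr assl !opprK.
have : T (ass x y z) *: 1%g = 0 :> A by rewrite -(sq_trace sqA) star_ass subrr.
rewrite -(scale0r 1%g) => /inj1; rewrite /ass sq_traceD -scaleN1r sq_traceZ mulN1r.
by move/subr0_eq.
Qed.

(* The radical of the polar form of N is a proper ideal, as T is associative. *)
Lemma sq_degenerate_not_simple : (2%:R : F) != 0 -> alternative A ->
  degenerate_form (polar N) -> ~ simple_alg A.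
Proof.
move=> n2 altA [x x0 Nx] [_ simpA].
pose R (y : A) := forall z, polar N y z = 0.
have [] := simpA R; last first.
- move=> RT; have : R 1%g by rewrite RT.
  move=> /(_ 1%g); rewrite sq_polar sq_star1 mul1g (sq_trace1 sqA) => h.
  by rewrite h eqxx in n2.
- by move=> R0; apply: x0; have : R x by []; rewrite R0.
have RE y : R y -> forall z, T (y ** z) = 0.
  by move=> Ry z; rewrite -[z](sq_invol sqA) -sq_polar.
have ER y : (forall z, T (y ** z) = 0) -> R y by move=> h z; rewrite sq_polar.
split.
- by apply: ER => z; rewrite nmul0l -(scale0r 0) sq_traceZ mul0r.
- by move=> y z /RE hy /RE hz; apply: ER => w; rewrite nmulDl sq_traceD hy hz addr0.
- by move=> c y /RE hy; apply: ER => w; rewrite nmulZl sq_traceZ hy mulr0.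
- by move=> y z /RE hz; apply: ER => w; rewrite sq_traceC -sq_traceA // sq_traceC hz.
- by move=> y z /RE hy; apply: ER => w; rewrite sq_traceA.
Qed.

(* If x lies in a proper ideal, then so does [u x + x u = T(x) u - N(u, x)], and
   multiplying by the anticommuting invertible elements u and v successively
   kills N(u, x) and T(x); applied to [x y^*] this kills N(x, y). *)
Lemma sq_simple (u v : A) : (2%:R : F) != 0 ->
    T u = 0 -> T v = 0 -> N u != 0 -> N v != 0 -> polar N u v = 0 ->
  ~ degenerate_form (polar N) -> simple_alg A.
Proof.
move=> n2 Tu Tv Nu Nv Nuv ndN; split; first exact: sq_F1 sqA.
move=> I [I0 ID IZ Il Ir].
have [I1|nI1] := pselect (I 1%g).
  by right; apply/seteqP; split=> // x _; rewrite -(mulg1 x); apply: Il.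
left; apply/seteqP; split=> [x Ix|_ -> //].
have II1 (c : F) : I (c *: 1%g) -> c = 0.
  move=> Ic; apply/eqP/negPn/negP => c0; apply: nI1.
  by rewrite -(scale1r 1%g) -(mulVf c0) -scalerA; apply: IZ.
have Iinv (c : F) w : T w = 0 -> N w != 0 -> I (c *: w) -> c = 0.
  move=> Tw Nw /(Ir _ w); rewrite nmulZl sq_mulxx Tw scale0r sub0r -scaleNr.
  by rewrite scalerA => /II1/eqP; rewrite mulf_eq0 oppr_eq0 (negbTE Nw) orbF => /eqP.
have IT y : I y -> T y = 0.
  move=> Iy.
  have Iuy : I (T y *: u - polar N y u *: 1%g).
    rewrite -[T y *: u]addr0 -(scale0r y) -Tu -sq_mulC.
    by apply: ID; [apply: Ir|apply: Il].
  have Nuy : polar N y u = 0.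
    (* Anticommute the element of [Iuy] with v: as u and v anticommute, only -2 N(y, u) v
       survives. *)
    have : I (- polar N y u *+ 2 *: v).
      have := ID _ _ (Ir _ v Iuy) (Il v _ Iuy).
      rewrite nmulBl nmulBr !nmulZl !nmulZr mul1g mulg1 addrACA -scalerDr.
      rewrite sq_mulC Tu Tv Nuv !scale0r addr0 subrr scaler0 add0r.
      by rewrite -opprD -scalerDl -scaleNr -mulr2n mulNrn.
    move=> /Iinv -/(_ Tv Nv)/eqP; rewrite -mulr_natr mulf_eq0.
    by rewrite (negbTE n2) orbF oppr_eq0 => /eqP.
  by move: Iuy; rewrite Nuy scale0r subr0 => /Iinv; apply.
apply: contrapT => x0; apply: ndN; exists x => // y.
by rewrite sq_polar IT //; apply: Ir.
Qed.

Lemma sq_normZ1 (c : F) : N (c *: 1%g) = c * c.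
Proof.
apply: inj1; rewrite /= -(sq_norm sqA) (linearfZ _ (sq_linear sqA)) sq_star1.
by rewrite nmulZl nmulZr mulg1 scalerA.
Qed.

End SymmetricQuadraticTheory.

(** Subtracting the two quadratic equations of x gives (T'(x) - T(x)) x = (N'(x) - N(x)) 1. Either
    the traces agree and so do the norms, or x = k1, whose norm is k^2 in both structures. *)
Lemma sq_norm_unique (F : fieldType) (A : nalgType F) (star star' : A -> A)
    (T T' N N' : A -> F) :
  symmetric_quadratic A star T N -> symmetric_quadratic A star' T' N' -> N =1 N'.
Proof.
move=> sq sq' x; have inj1 := nscale1_inj (sq_F1 sq).
have := sq_mulxx sq x; rewrite (sq_mulxx sq') => /eqP.
rewrite subr_eq -addrA addrC -subr_eq addrC -scaleNr -scalerDl => /eqP.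
have [->|T'x] := eqVneq (T' x) (T x).
  by rewrite subrr scale0r => /esym/subr0_eq/inj1.
rewrite -scalerBl => Nx.
have [k ->] : exists k, x = k *: 1%g.
  exists ((T' x - T x)^-1 * (N' x - N x)).
  by rewrite -scalerA -Nx scalerA mulVf ?scale1r // subr_eq0.
by rewrite (sq_normZ1 sq) (sq_normZ1 sq').
Qed.

(** * The Cayley-Dickson doubling *)

Section Doubling.
Variables (F : fieldType) (D : nalgType F) (star : D -> D) (T N : D -> F).

(* The doubling of D: the pair (x, y) stands for x + y e with e ^ 2 = c. *)
Definition cd (sqD : symmetric_quadratic D star T N) (c : F) : Type :=
  (D * D)%type.

Variables (sqD : symmetric_quadratic D star T N) (c : F).

HB.instance Definition _ := GRing.Lmodule.copy (cd sqD c) (D * D)%type.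

(** The Cayley-Dickson product, encoding the rules x(ye) = (yx)e, (xe)y = (x [star y])e and (xe)(ye)
    = c ([star y] x). *)
Definition cd_mul (x y : cd sqD c) : cd sqD c :=
  (x.1 ** y.1 + c *: (star y.2 ** x.2), y.2 ** x.1 + x.2 ** star y.1).
Definition cd_one : cd sqD c := (1%g, 0).

Fact cd_mul1 : left_id cd_one cd_mul.
Proof.
by move=> [x y]; rewrite /cd_mul /= mul1g mulg1 nmul0l nmul0r scaler0 !addr0.
Qed.

Fact cd_1mul : right_id cd_one cd_mul.
Proof.
move=> [x y]; rewrite /cd_mul /= (sq_star1 sqD) (linearf0 (sq_linear sqD)).
by rewrite !mulg1 !nmul0l scaler0 addr0 add0r.
Qed.

HB.instance Definition _ := hasMul.Build (cd sqD c) cd_mul.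
HB.instance Definition _ := Magma_isUMagma.Build (cd sqD c) cd_mul1 cd_1mul.

Lemma cdM (x1 x2 y1 y2 : D) : ((x1, x2) : cd sqD c) ** (y1, y2) =
  (x1 ** y1 + c *: (star y2 ** x2), y2 ** x1 + x2 ** star y1) :> cd sqD c.
Proof. by []. Qed.

Lemma cdD (x1 x2 y1 y2 : D) : ((x1, x2) : cd sqD c) + (y1, y2) = (x1 + y1, x2 + y2).
Proof. by []. Qed.

Lemma cdZ (k : F) (x1 x2 : D) : k *: ((x1, x2) : cd sqD c) = (k *: x1, k *: x2).
Proof. by []. Qed.

Lemma cd1E : 1%g = (1%g, 0) :> cd sqD c.
Proof. by []. Qed.

Let sL := sq_linear sqD.
Let sD := linearfD sL.
Let sZ k := linearfZ k sL.

Fact cd_nmulDl (x y z : cd sqD c) : (x + y) ** z = x ** z + y ** z.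
Proof.
case: x y z => [x1 x2] [y1 y2] [z1 z2]; rewrite !(cdD, cdZ, cdM).
by rewrite !(nmulDl, nmulDr) scalerDr; congr pair; rewrite addrACA.
Qed.

Fact cd_nmulDr (x y z : cd sqD c) : x ** (y + z) = x ** y + x ** z.
Proof.
case: x y z => [x1 x2] [y1 y2] [z1 z2]; rewrite !(cdD, cdZ, cdM).
by rewrite !sD !(nmulDl, nmulDr) scalerDr; congr pair; rewrite addrACA.
Qed.

Fact cd_nmulZl (k : F) (x y : cd sqD c) : (k *: x) ** y = k *: (x ** y).
Proof.
case: x y => [x1 x2] [y1 y2]; rewrite !(cdD, cdZ, cdM).
by rewrite !(nmulZl, nmulZr) [c *: (k *: _)]scalerA (mulrC c) -scalerA;
  congr pair; rewrite scalerDr.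
Qed.

Fact cd_nmulZr (k : F) (x y : cd sqD c) : x ** (k *: y) = k *: (x ** y).
Proof.
case: x y => [x1 x2] [y1 y2]; rewrite !(cdD, cdZ, cdM).
by rewrite !sZ !(nmulZl, nmulZr) [c *: (k *: _)]scalerA (mulrC c) -scalerA;
  congr pair; rewrite scalerDr.
Qed.

HB.instance Definition _ := LmoduleUMagma_isNAlgebra.Build F (cd sqD c)
  cd_nmulDl cd_nmulDr cd_nmulZl cd_nmulZr.

Definition cd_star (x : cd sqD c) : cd sqD c := (star x.1, - x.2).
Definition cd_trace (x : cd sqD c) : F := T x.1.
Definition cd_norm (x : cd sqD c) : F := N x.1 - c * N x.2.

(** Doubling stays within symmetric quadratic algebras, which is what allows it to be iterated. *)
Lemma cd_symmetric_quadratic :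
  symmetric_quadratic (cd sqD c) cd_star cd_trace cd_norm.
Proof.
apply: symmetric_quadratic_intro.
- by move=> /(congr1 (fun x : cd sqD c => x.1)); apply: sq_F1 sqD.
- move=> k [x1 x2] [y1 y2]; rewrite /cd_star /=; congr pair; first by rewrite sL.
  by rewrite /= opprD scalerN.
- by rewrite /cd_star /= oppr0 (sq_star1 sqD).
- move=> [x1 x2] [y1 y2]; rewrite /cd_star cdM /= cdM.
  rewrite sD sZ !(sq_anti sqD) !(sq_invol sqD) (linearfN sL) !nmulNl nmulNr opprK.
  by congr pair; rewrite opprD addrC.
- move=> [x1 x2]; rewrite /cd_star /cd_trace cd1E cdD cdZ /=.
  by rewrite (sq_trace sqD) subrr scaler0.
- move=> [x1 x2]; rewrite /cd_star /cd_norm cd1E cdZ cdM /=.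
  rewrite (sq_norm sqD) (linearfN sL) nmulNl (sq_norml sqD) scalerN.
  by rewrite scalerA scalerBl scaler0 (sq_invol sqD) nmulNl addNr.
Qed.

(* It suffices that a^* (a b) = N(a) b; the right law follows by conjugation. *)
Lemma cd_alternative : (forall x y z : D, x ** (y ** z) = x ** y ** z) ->
  alternative (cd sqD c).
Proof.
move=> mulA; have sq := cd_symmetric_quadratic.
have starK (a b : cd sqD c) : cd_star a ** (a ** b) = cd_norm a *: b.
  case: a b => [x1 x2] [y1 y2]; rewrite /cd_star /cd_norm !cdM cdZ /=.
  congr pair.
    rewrite sD !(sq_anti sqD) (sq_invol sqD) nmulDr nmulDl nmulZr !nmulNr.
    rewrite -!mulA [star x1 ** (x1 ** _)]mulA !(sq_norml sqD).
    rewrite nmulZl mul1g nmulZr mulg1.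
    by rewrite scalerDr !scalerN addrA addrK scalerA scalerBl.
  rewrite sD sZ !(sq_anti sqD) !(sq_invol sqD) nmulDl nmulDr !nmulZr !nmulNl.
  rewrite -!mulA [x2 ** (star x2 ** _)]mulA !(sq_norm sqD) nmulZr mulg1 nmulZl mul1g.
  by rewrite scalerN addrA addrK scalerA scalerBl.
have altl (a b : cd sqD c) : a ** (a ** b) = a ** a ** b.
  have aE w : a ** w = cd_trace a *: w - cd_star a ** w.
    by rewrite (sq_starE sq) nmulBl nmulZl mul1g subKr.
  by rewrite aE starK (sq_mulxx sq) nmulBl !nmulZl mul1g.
split=> [//|a b]; apply: (can_inj (sq_invol sq)).
by rewrite !(sq_anti sq) altl.
Qed.

(** Each component of either side expands into four triple products; they agree up to order, D being
    associative and commutative. *)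
Lemma cd_associative : (forall x y z : D, x ** (y ** z) = x ** y ** z) ->
  (forall x y : D, x ** y = y ** x) ->
  forall x y z : cd sqD c, x ** (y ** z) = x ** y ** z.
Proof.
move=> mulA mulC [x1 x2] [y1 y2] [z1 z2]; rewrite !cdM.
rewrite !(sD, sZ, sq_anti sqD) !(sq_invol sqD) !nmulDl !nmulDr !(nmulZl, nmulZr).
rewrite !scalerDr !mulA.
have mulAC (x y z : D) : x ** y ** z = x ** z ** y by rewrite -!mulA (mulC y).
have mulCA (x y z : D) : x ** y ** z = y ** z ** x by rewrite -mulA (mulC x).
have addE (p q r s : D) : p + q + (r + s) = p + s + (q + r).
  by rewrite -!addrA [q + (r + s)]addrA [q + r + s]addrC.
congr pair; rewrite addE.
  by rewrite (mulCA z1) (mulCA x1 (star z2)) (mulCA (star y1)).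
by rewrite (mulAC z2) (mulAC y2) (mulAC x2 (star z1)) (mulCA x2 (star y2))
  (mulC _ z2).
Qed.

Lemma cd_commutative : star =1 id -> (forall x y : D, x ** y = y ** x) ->
  forall x y : cd sqD c, x ** y = y ** x.
Proof.
move=> sid mulC [x1 x2] [y1 y2]; rewrite !cdM !sid.
congr pair; last exact: addrC.
by congr (_ + c *: _); apply: mulC.
Qed.

End Doubling.

Arguments cd_norm {F D star T N} sqD c x.

(** * Homomorphisms out of a doubling *)

Section DoublingHom.
Variables (F : fieldType) (D : nalgType F) (star : D -> D) (T N : D -> F).
Variables (sqD : symmetric_quadratic D star T N) (c : F).

Definition cd_in (x : D) : cd sqD c := (x, 0).
(** The adjoined element e with e^2 = c; the unit of the doubling is [cd_one]. *)
Definition cd_unit : cd sqD c := (0, 1%g).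

Lemma cd_in_hom : nalg_hom cd_in.
Proof.
split=> [k x y||x y] //; rewrite /cd_in ?cdM ?cdZ ?cdD ?scaler0 ?addr0 //.
by rewrite !nmul0l nmul0r scaler0 !addr0.
Qed.

Lemma cd_inM_unit (x y : D) : cd_in x + cd_in y ** cd_unit = (x, y).
Proof.
rewrite cdM cdD (linearf0 (sq_linear sqD)) mul1g !nmul0r scaler0.
by rewrite !addr0 add0r.
Qed.

Definition cd_ext (A : nalgType F) (f : D -> A) (e : A) (x : cd sqD c) : A :=
  f x.1 + f x.2 ** e.

(** Every element is x + ye, so agreement on D and on e suffices. Applied once per layer, this shows
    that a map on the tower is the identity. *)
Lemma cd_ext_unique (A A' : nalgType F) (f : D -> A) (e : A) (g : A -> A')
    (h : cd sqD c -> A') :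
  nalg_hom g -> nalg_hom h -> (forall x, g (f x) = h (cd_in x)) ->
  g e = h cd_unit -> forall x, g (cd_ext f e x) = h x.
Proof.
move=> [gL _ gM] [hL _ hM] gf ge [x y].
by rewrite /cd_ext /= (linearfD gL) gM !gf ge -hM -(linearfD hL) cd_inM_unit.
Qed.

(* Linearizing the alternative laws forces the doubling product on f(D) + f(D) e. *)
Lemma cd_ext_hom (A : nalgType F) (f : D -> A) (e : A) :
  alternative A -> nalg_hom f -> e ** e = c *: 1%g ->
  (forall x, f x ** e = e ** f (star x)) -> nalg_hom (cd_ext f e).
Proof.
move=> altA [fL f1 fM] ee fe; have [_ ar] := altA.
have f0 := linearf0 fL; have fD := linearfD fL; have fZ k := linearfZ k fL.
have fT x y : T x *: f y - f (y ** x) = f (y ** star x).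
  by rewrite (sq_starE sqD) nmulBr nmulZr mulg1 fD (linearfN fL) fZ.
have fT' x y : T x *: f y - f (x ** y) = f (star x ** y).
  by rewrite (sq_starE sqD) nmulBl nmulZl mul1g fD (linearfN fL) fZ.
have ef x : e ** f x = f (star x) ** e by rewrite fe (sq_invol sqD).
have fee x : e ** f x + f x ** e = T x *: e.
  by rewrite ef -nmulDl -fD addrC (sq_trace sqD) fZ f1 nmulZl mul1g.
have fxfye x y : f x ** (f y ** e) = f (y ** x) ** e.
  (* Writing f(y)e as e f([star y]) brings the linearized left law to bear. *)
  have := altl_lin altA (f x) e (f (star y)).
  rewrite -fe [f x ** e + _]addrC fee nmulZl -fe -fM ef (sq_anti sqD) (sq_invol sqD).
  by move/(canRL (addrK _)) ->; rewrite -nmulZl -nmulBl -fT opprB addrC subrK.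
have fxefy x y : (f x ** e) ** f y = f (x ** star y) ** e.
  have := altr_lin altA (f x) e (f y); rewrite fee -fM nmulZr.
  by move/(canRL (addrK _)) ->; rewrite -nmulZl -nmulBl fT.
have fxefye x y : (f x ** e) ** (f y ** e) = c *: f (star y ** x).
  have := altl_lin altA (f x ** e) (f y) e.
  rewrite fxefy fxfye -nmulDl -fD -nmulDr [star y + y]addrC (sq_trace sqD).
  rewrite nmulZr mulg1 fZ.
  rewrite -!ar ee !nmulZr !mulg1 -fM.
  by move/(canRL (addrK _)) ->; rewrite -scalerBr fT'.
split=> [k [x1 x2] [y1 y2]||[x1 x2] [y1 y2]]; rewrite /cd_ext /=.
- by rewrite !fL nmulDl nmulZl scalerDr addrACA.
- by rewrite f1 f0 nmul0l addr0.
rewrite !nmulDl !nmulDr fxfye fxefy fxefye -fM !fD fZ nmulDl.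
by rewrite -!addrA; congr (_ + _); rewrite [RHS]addrA [LHS]addrC.
Qed.

End DoublingHom.

(** * Norm form and dimension of a doubling *)

Section DoublingForms.
Variables (F : fieldType) (D : nalgType F) (star : D -> D) (T N : D -> F).
Variables (sqD : symmetric_quadratic D star T N) (c : F).

Lemma cd_polar (x y : cd sqD c) :
  polar (cd_norm sqD c) x y = polar N x.1 y.1 - c * polar N x.2 y.2.
Proof. by rewrite /polar /cd_norm /=; ring. Qed.

(** The polar form is the orthogonal sum of that of N and of -c times it, so its radical is found
    componentwise. For c = 0 it contains (0, 1). *)
Lemma cd_degenerate :
  degenerate_form (polar (cd_norm sqD c)) <->
    c = 0 \/ degenerate_form (polar N).
Proof.
have N0 x : polar N x 0 = 0.
  rewrite (sq_polar sqD) (linearf0 (sq_linear sqD)) nmul0r.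
  by rewrite -(scale0r 0) (sq_traceZ sqD) mul0r.
have N0l y : polar N 0 y = 0.
  by rewrite (sq_polar sqD) nmul0l -(scale0r 0) (sq_traceZ sqD) mul0r.
split=> [[[x1 x2] x0 Nx]|[c0|[x x0 Nx]]].
- have [c0|c0] := eqVneq c 0; [by left|right].
  have [x10|/eqP x10] := eqVneq x1 0; last first.
    by exists x1 => // y; have := Nx (y, 0); rewrite cd_polar /= N0 mulr0 subr0.
  exists x2 => [x20|y]; first by apply: x0; rewrite x10 x20.
  have /eqP := Nx (0, y); rewrite cd_polar /= x10 N0 sub0r oppr_eq0.
  by rewrite mulf_eq0 (negbTE c0) => /eqP.
- exists (0, 1%g) => [|[y1 y2]]; last by rewrite cd_polar /= N0l c0 mul0r subrr.
  by move/(congr1 (fun x : cd sqD c => x.2)); apply: sq_F1 sqD.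
- exists (x, 0) => [|[y1 y2]]; last by rewrite cd_polar /= N0l Nx mulr0 subrr.
  by move/(congr1 (fun x : cd sqD c => x.1)).
Qed.

Lemma cd_has_dim n : has_dim D n -> has_dim (cd sqD c) (n + n).
Proof.
move=> [f [fL [g gf fg]]]; exists (fun x => row_mx (f x.1) (f x.2)); split.
  by move=> k x y; rewrite /= !fL scale_row_mx add_row_mx.
exists (fun v => (g (lsubmx v), g (rsubmx v))) => [[x y]|v] /=.
  by rewrite row_mxKl row_mxKr !gf.
by rewrite !fg hsubmxK.
Qed.

End DoublingForms.

(** * The field as the base of the tower *)

Section BaseAlgebra.
Variable F : fieldType.

(** An alias of F, on which the field product serves as the product of a [nalgType]. *)
Definition base_alg : Type := F.
HB.instance Definition _ := GRing.Lmodule.copy base_alg (F^o).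
HB.instance Definition _ := hasMul.Build base_alg (fun x y : F => x * y).
HB.instance Definition _ := Magma_isUMagma.Build base_alg
  (@mul1r F : left_id (1 : F) (fun x y : base_alg => x ** y)) (@mulr1 F).

Fact base_nmulDl (x y z : base_alg) : (x + y) ** z = x ** z + y ** z.
Proof. exact: mulrDl. Qed.
Fact base_nmulDr (x y z : base_alg) : x ** (y + z) = x ** y + x ** z.
Proof. exact: mulrDr. Qed.
Fact base_nmulZl (k : F) (x y : base_alg) : (k *: x) ** y = k *: (x ** y).
Proof. by apply/esym; apply: mulrA. Qed.
Fact base_nmulZr (k : F) (x y : base_alg) : x ** (k *: y) = k *: (x ** y).
Proof. exact: mulrCA. Qed.
HB.instance Definition _ := LmoduleUMagma_isNAlgebra.Build F base_alg
  base_nmulDl base_nmulDr base_nmulZl base_nmulZr.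

Definition base_trace (x : base_alg) : F := (x : F) *+ 2.
Definition base_norm (x : base_alg) : F := (x : F) * x.

Lemma base_symmetric_quadratic :
  symmetric_quadratic base_alg id base_trace base_norm.
Proof.
apply: symmetric_quadratic_intro => //.
- by apply/eqP; apply: oner_neq0.
- by move=> x y; apply: mulrC.
- by move=> x; rewrite /base_trace mulr2n [RHS]mulr1.
- by move=> x; rewrite /base_norm [RHS]mulr1.
Qed.

Lemma base_has_dim : has_dim base_alg 1.
Proof.
exists (fun x => const_mx x : 'rV[F]_1); split.
  by move=> k x y; apply/rowP => i; rewrite !mxE.
exists (fun v : 'rV[F]_1 => v 0 0) => [x|v]; first by rewrite mxE.
by apply/rowP => i; rewrite mxE ord1.
Qed.

Lemma base_hom (A : nalgType F) :
  nalg_hom (fun x : base_alg => (x : F) *: (1%g : A)).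
Proof.
split=> [k x y||x y].
- by rewrite scalerA scalerDl.
- exact: scale1r.
- by rewrite nmulZl mul1g scalerA.
Qed.

End BaseAlgebra.

Lemma base_polar (F : fieldType) (x y : F) :
  polar (@base_norm F) x y = x * y *+ 2.
Proof.
rewrite /polar /base_norm.
by change ((x + y) * (x + y) - x * x - y * y = x * y *+ 2); ring.
Qed.

Lemma base_nondegenerate (F : fieldType) : (2%:R : F) != 0 ->
  ~ degenerate_form (polar (@base_norm F)).
Proof.
move=> n2 [x x0 /(_ (1 : F))/eqP]; rewrite base_polar mulr1 -mulr_natr.
by rewrite mulf_eq0 (negbTE n2) orbF => /eqP.
Qed.

(** * Octonion algebras with arbitrary, possibly zero, parameters *)

Section Octonions.
Variables (F : fieldType) (a b c : F).

Definition cd1_sq := cd_symmetric_quadratic (base_symmetric_quadratic F) a.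
Definition cd2_sq := cd_symmetric_quadratic cd1_sq b.
Definition octonion : nalgType F := cd cd2_sq c.
Definition octonion_norm : octonion -> F := cd_norm cd2_sq c.
Definition octonion_sq : symmetric_quadratic octonion _ _ octonion_norm :=
  cd_symmetric_quadratic cd2_sq c.

(** F is commutative with trivial conjugation, so the first doubling is commutative and associative,
    the second associative, the third alternative. *)
Lemma octonion_alternative : alternative octonion.
Proof.
apply: cd_alternative; apply: cd_associative.
  by apply: cd_associative => [x y z|x y]; [apply: mulrA|apply: mulrC].
by apply: cd_commutative => // x y; apply: mulrC.
Qed.

Lemma octonion_has_dim : has_dim octonion 8.
Proof. exact: cd_has_dim (cd_has_dim _ _ (cd_has_dim _ _ (base_has_dim F))). Qed.

Lemma octonion_degenerate : (2%:R : F) != 0 ->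
  degenerate_form (polar octonion_norm) <-> a = 0 \/ b = 0 \/ c = 0.
Proof.
by move=> n2; rewrite !cd_degenerate; have := base_nondegenerate n2; tauto.
Qed.

(** The combination x e1 + y e2 + z e3 of the three adjoined elements. These form the image of V,
    not the whole space of trace 0. *)
Definition pure_octonion (x y z : F) : octonion :=
  (((0, x), (y, 0)), ((z, 0), 0)).

Lemma pure_octonion_polar (p : octonion) (x y z : F) :
  polar octonion_norm p (pure_octonion x y z) =
  - (a * p.1.1.2 * x + b * p.1.2.1 * y + c * p.2.1.1 * z) *+ 2.
Proof.
rewrite !cd_polar /= !base_polar; change (0 : base_alg F) with (0 : F).
by ring.
Qed.

Lemma pure_octonion_norm (x y z : F) :
  octonion_norm (pure_octonion x y z) = - (a * x * x + b * y * y + c * z * z).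
Proof.
rewrite /octonion_norm /cd_norm /= /base_norm.
by change (0 : base_alg F) with (0 : F); ring.
Qed.

Lemma pure_octonion_trace (x y z : F) : cd_trace (pure_octonion x y z) = 0.
Proof. exact: mul0rn. Qed.

Lemma pure_octonion_mulC (x1 x2 x3 y1 y2 y3 : F) :
  let u := pure_octonion x1 x2 x3 in let v := pure_octonion y1 y2 y3 in
  u ** v + v ** u = (a * x1 * y1 + b * x2 * y2 + c * x3 * y3) *+ 2 *: 1%g.
Proof.
rewrite /= (sq_mulC octonion_sq) !pure_octonion_trace pure_octonion_polar.
by rewrite !scale0r addr0 sub0r -scaleNr mulNrn opprK.
Qed.

(** The product uv involves only 1 and the products ei ej, so it is orthogonal to w and (uv)w has
    trace 0. Conjugation thus negates (uv)w; it also sends it to -w(vu), as it negates u, v and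
    w. *)
Lemma pure_octonion_rev (x1 x2 x3 y1 y2 y3 z1 z2 z3 : F) :
  let u := pure_octonion x1 x2 x3 in let v := pure_octonion y1 y2 y3 in
  let w := pure_octonion z1 z2 z3 in
  (u ** v) ** w = w ** (v ** u).
Proof.
set u := pure_octonion x1 _ _; set v := pure_octonion y1 _ _.
set w := pure_octonion z1 _ _; move=> /=.
have starE x y z : cd_star (pure_octonion x y z) = - pure_octonion x y z.
  by rewrite (sq_starE octonion_sq) pure_octonion_trace scale0r sub0r.
(* The coordinates of uv along e1, e2 and e3, which are those seen by [pure_octonion_polar]. *)
have uv1 : (u ** v).1.1.2 = 0.
  by rewrite /= !(oppr0, nmul0l, nmul0r, scaler0, addr0).
have uv2 : (u ** v).1.2.1 = 0.
  by rewrite /= !(oppr0, nmul0l, nmul0r, scaler0, addr0).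
have uv3 : (u ** v).2.1.1 = 0.
  by rewrite /= !(oppr0, nmul0l, nmul0r, scaler0, addr0).
have T0 : cd_trace ((u ** v) ** w) = 0.
  apply: oppr_inj; rewrite oppr0 -mulN1r -(sq_traceZ octonion_sq) scaleN1r.
  rewrite -nmulNr -starE -(sq_polar octonion_sq) pure_octonion_polar.
  by rewrite uv1 uv2 uv3 !(mulr0, mul0r, addr0) oppr0 mul0rn.
have := sq_starE octonion_sq ((u ** v) ** w).
rewrite T0 scale0r sub0r !(sq_anti octonion_sq) !starE !(nmulNl, nmulNr) !opprK.
by move/oppr_inj.
Qed.

Lemma octonion_simple : (2%:R : F) != 0 ->
  simple_alg octonion <-> ~ (a = 0 \/ b = 0 \/ c = 0).
Proof.
move=> n2; rewrite -octonion_degenerate //; split=> [simpO degO|ndO].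
  exact: sq_degenerate_not_simple octonion_sq n2 octonion_alternative degO simpO.
have [/eqP a0 /eqP b0] : a <> 0 /\ b <> 0.
  by rewrite octonion_degenerate // in ndO; split=> ?; apply: ndO; tauto.
(* Take e1 and e2: traceless, orthogonal, of norms -a and -b. *)
apply: (sq_simple octonion_sq (u := pure_octonion 1 0 0) (v := pure_octonion 0 1 0));
  rewrite ?pure_octonion_trace ?pure_octonion_norm ?pure_octonion_polar //.
- by rewrite !mulr0 !mulr1 !addr0 oppr_eq0.
- by rewrite !mulr0 !mulr1 add0r addr0 oppr_eq0.
- by rewrite !(mulr0, mul0r, mulr1) !addr0 oppr0 mul0rn.
Qed.

End Octonions.

(** * Transport along an isomorphism *)

Section Isomorphism.
Variables (F : fieldType) (A A' : nalgType F) (f : A -> A') (g : A' -> A).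
Hypotheses (fH : nalg_hom f) (fK : cancel f g) (gK : cancel g f).

Lemma nalg_hom_can : nalg_hom g.
Proof.
case: fH => fL f1 fM; split=> [c x y||x y]; apply: (can_inj fK).
- by rewrite fL !gK.
- by rewrite gK f1.
- by rewrite fM !gK.
Qed.

Let gH := nalg_hom_can.

Lemma iso_has_dim n : has_dim A n -> has_dim A' n.
Proof.
move=> [h [hL hB]]; exists (h \o g); split.
  by move=> c x y; case: gH => gL _ _; rewrite /= gL hL.
by apply: bij_comp hB _; exists f.
Qed.

Lemma iso_simple : simple_alg A -> simple_alg A'.
Proof.
case: fH gH => fL f1 fM [gL g1 gM] [n1 simpA]; split.
  by move=> h; apply: n1; rewrite -g1 h (linearf0 gL).
move=> I [I0 ID IZ Ir Il].
pose J x := I (f x); have [] := simpA J.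
- rewrite /J; split=> [|x y Ix Iy|c x Ix|x y Iy|x y Ix].
  + by rewrite (linearf0 fL).
  + by rewrite (linearfD fL); apply: ID.
  + by rewrite (linearfZ _ fL); apply: IZ.
  + by rewrite fM; apply: Ir.
  + by rewrite fM; apply: Il.
- move=> fI0; left; apply/seteqP; split=> [y Iy|_ -> //].
  have : J (g y) by rewrite /J gK.
  by rewrite fI0 => /(congr1 f); rewrite gK (linearf0 fL).
- move=> fIT; right; apply/seteqP; split=> // y _.
  have : J (g y) by rewrite fIT.
  by rewrite /J gK.
Qed.

Lemma iso_symmetric_quadratic (star : A -> A) (T N : A -> F) :
  symmetric_quadratic A star T N ->
  symmetric_quadratic A' (f \o star \o g) (T \o g) (N \o g).
Proof.
case: fH gH => fL f1 fM [gL g1 gM] sq; apply: symmetric_quadratic_intro.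
- by move=> h; apply: (sq_F1 sq); rewrite -g1 h (linearf0 gL).
- by move=> c x y; rewrite /= gL (sq_linear sq) fL.
- by rewrite /= g1 (sq_star1 sq) f1.
- by move=> x y; rewrite /= gM (sq_anti sq) fM.
- move=> x; rewrite /= -[x in x + _]gK -(linearfD fL) (sq_trace sq).
  by rewrite (linearfZ _ fL) f1.
- move=> x; rewrite /= -[x in x ** _]gK -fM (sq_norm sq).
  by rewrite (linearfZ _ fL) f1.
Qed.

Lemma iso_degenerate (N : A -> F) :
  degenerate_form (polar (N \o g)) <-> degenerate_form (polar N).
Proof.
case: fH gH => fL f1 fM [gL g1 gM]; split=> [[x x0 Nx]|[x x0 Nx]].
- exists (g x) => [gx0|y]; first by apply: x0; rewrite -(gK x) gx0 (linearf0 fL).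
  by rewrite -(Nx (f y)) /polar /= (linearfD gL) fK.
- exists (f x) => [fx0|y]; first by apply: x0; rewrite -(fK x) fx0 (linearf0 gL).
  by rewrite -(Nx (g y)) /polar /= (linearfD gL) fK.
Qed.

End Isomorphism.

(** * Quotients by generated ideals *)

Section Quotient.
Variables (F : fieldType) (A A' : nalgType F) (S : set A).

Lemma quot_alternative : alternative A -> alternative (quot_alg S).
Proof.
case: (quot_pi_hom S) => _ _ piM [al ar].
split; elim/quot_ind=> x; elim/quot_ind=> y.
  by rewrite -(piM x y) -(piM x x) -(piM x (x ** y)) -(piM (x ** x) y) al.
by rewrite -(piM y x) -(piM x x) -(piM y (x ** x)) -(piM (y ** x) x) ar.
Qed.

Lemma quot_pi0 x : S x -> quot_pi S x = 0.
Proof.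
case: (quot_pi_hom S) => piL _ _ Sx; rewrite -(linearf0 piL).
by apply/quot_piP; rewrite subr0; apply/ideal_genP => I _; apply.
Qed.

(** The kernel of g is a two-sided ideal containing S, so g is constant on classes and can be
    evaluated at chosen representatives. *)
Lemma quot_universal (g : A -> A') : nalg_hom g -> (forall x, S x -> g x = 0) ->
  exists2 h : quot_alg S -> A', nalg_hom h & forall x, h (quot_pi S x) = g x.
Proof.
move=> [gL g1 gM] gS; have [piL pi1 piM] := quot_pi_hom S.
have gI x : x \in ideal_gen S -> g x = 0.
  move=> /ideal_genP /(_ (fun x => g x = 0)); apply=> //.
  split=> [|y z|c y|y z|y z] /=.
  - exact: linearf0.
  - by move=> gy gz; rewrite (linearfD gL) gy gz addr0.
  - by move=> gy; rewrite (linearfZ _ gL) gy scaler0.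
  - by move=> gz; rewrite gM gz nmul0r.
  - by move=> gy; rewrite gM gy nmul0l.
have hE x : g (repr (quot_pi S x)) = g x.
  apply/eqP; rewrite -subr_eq0 -(linearfN gL) -(linearfD gL).
  by apply/eqP/gI/reprB.
exists (fun x => g (repr x)) => //; split.
- move=> c; elim/quot_ind=> x; elim/quot_ind=> y.
  by rewrite -piL !hE gL.
- by rewrite -pi1 hE.
- by elim/quot_ind=> x; elim/quot_ind=> y; rewrite -piM !hE gM.
Qed.

End Quotient.

(** * Orthogonal bases of symmetric bilinear forms *)

(** Induction on dim U. If B(v, v) is nonzero for some v in U, split off v: its orthogonal in U has
    one dimension less. Otherwise polarization, with 2 invertible, makes B vanish on U and any basis
    will do. *)
Lemma orthogonal_basis (F : fieldType) (V : vectType F) (B : {symmetric V})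
    (U : {vspace V}) : (2%:R : F) != 0 ->
  exists2 s : seq V, basis_of U s & pairwise (fun u v => B u v == 0) s.
Proof.
move=> n2; have BC u v : B u v = B v u.
  by rewrite hermC /= expr0 mul1r.
move: {2}(\dim U) (erefl (\dim U)) => n; elim: n U => [|n IHn] U dimU.
  exists [::] => //; rewrite basisEdim /= dimU andbT.
  by rewrite span_nil subv0 -dimv_eq0 dimU.
have [[v vU Bv]|B0] := pselect (exists2 v, v \in U & B v v != 0); last first.
  exists (vbasis U); first exact: vbasisP.
  have B0' v : v \in U -> B v v = 0.
    by move=> vU; apply/eqP; apply: contrapT => /negP Bv; apply: B0; exists v.
  apply/(pairwiseP 0) => i j; rewrite !inE => ilt jlt _.
  have iU := vbasis_mem (mem_nth 0 ilt); have jU := vbasis_mem (mem_nth 0 jlt).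
  have := B0' _ (memvD iU jU); rewrite linearDl !linearD /= !B0' //.
  rewrite add0r addr0 BC => /eqP; rewrite -mulr2n -mulr_natr mulf_eq0.
  by rewrite (negbTE n2) orbF.
have vNorth : v \notin orthov B U by apply/mem_orthovPn; exists v.
have dimW := eq_dim_orthov1 vNorth.
have [s sW sP] := IHn (U :&: orthov B <[v]>)%VS
  (etrans (esym dimW) (congr1 predn dimU)).
exists (v :: s); last first.
  rewrite pairwise_cons sP andbT; apply/allP => w ws.
  have : w \in (U :&: orthov B <[v]>)%VS.
    by rewrite -(span_basis sW); apply: memv_span.
  by rewrite memv_cap mem_orthov1 BC => /andP[].
have sU : (<<v :: s>> <= U)%VS.
  by rewrite span_cons subv_add -memvE vU (span_basis sW) capvSl.
rewrite basisEfree free_cons (basis_free sW) (span_basis sW) sU andbT.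
rewrite memv_cap vU mem_orthov1 Bv /= dimU ltnS.
by rewrite -[n]/(n.+1.-1) -dimU dimW -(span_basis sW) dim_span.
Qed.

(** The coordinate functions come along with the basis, valued in [F^o] so that their linearity can
    be stated. *)
Lemma orthogonal_basis3 (F : fieldType) (V : vectType F) (B : {symmetric V}) :
    (2%:R : F) != 0 -> \dim {:V} = 3%N ->
  exists (e1 e2 e3 : V) (k1 k2 k3 : V -> F^o),
    [/\ [/\ linear k1, linear k2 & linear k3],
        [/\ B e1 e2 = 0, B e1 e3 = 0 & B e2 e3 = 0],
        forall v, v = k1 v *: e1 + k2 v *: e2 + k3 v *: e3
      & [/\ [/\ k1 e1 = 1, k1 e2 = 0 & k1 e3 = 0],
            [/\ k2 e1 = 0, k2 e2 = 1 & k2 e3 = 0]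
          & [/\ k3 e1 = 0, k3 e2 = 0 & k3 e3 = 1]]].
Proof.
move=> n2 dimV; have [s sB sP] := orthogonal_basis B fullv n2.
have s3 : size s == 3%N.
  have /eqP <- := basis_free sB; apply/eqP; rewrite (span_basis sB).
  exact: dimV.
pose e := Tuple s3; have eB : basis_of fullv e by [].
have free_e := basis_free eB.
have o i j : (i < j < 3)%N -> B e`_i e`_j = 0.
  case/andP=> ij j3; apply/eqP; apply: (pairwiseP 0 sP) => //;
    rewrite inE (eqP s3) //.
  exact: ltn_trans j3.
pose i1 := @Ordinal 3 0 isT; pose i2 := @Ordinal 3 1 isT.
pose i3 := @Ordinal 3 2 isT.
exists e`_0, e`_1, e`_2, (coord e i1), (coord e i2), (coord e i3); split.
- by split=> k u v; rewrite linearP.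
- by split; apply: o.
- move=> v; rewrite {1}(coord_basis eB (memvf v)) !big_ord_recl big_ord0 addr0 addrA.
  have -> : ord0 = i1 by apply/val_inj.
  have -> : lift i1 ord0 = i2 by apply/val_inj.
  have -> : lift i1 (lift ord0 ord0) = i3 by apply/val_inj.
  by [].
- have kE i j : coord e i e`_(val j) = (i == j)%:R by rewrite coord_free // eq_sym.
  by split; (split; [exact: (kE _ i1)|exact: (kE _ i2)|exact: (kE _ i3)]).
Qed.

(** * The Kingdon algebra as an octonion algebra *)

Section KingdonOctonion.
Variables (F : fieldType) (V : vectType F) (B : {symmetric V}).
Hypothesis n2 : (2%:R : F) != 0.
Variables (e1 e2 e3 : V) (k1 k2 k3 : V -> F^o).
Hypotheses (k1L : linear k1) (k2L : linear k2) (k3L : linear k3).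
Hypotheses (B12 : B e1 e2 = 0) (B13 : B e1 e3 = 0) (B23 : B e2 e3 = 0).
Hypothesis kE : forall v, v = k1 v *: e1 + k2 v *: e2 + k3 v *: e3.
Hypotheses (k11 : k1 e1 = 1) (k12 : k1 e2 = 0) (k13 : k1 e3 = 0).
Hypotheses (k21 : k2 e1 = 0) (k22 : k2 e2 = 1) (k23 : k2 e3 = 0).
Hypotheses (k31 : k3 e1 = 0) (k32 : k3 e2 = 0) (k33 : k3 e3 = 1).

(** Since 2 v^2 = B(v, v) in K(V, B), these are the squares of the ei there, hence the parameters of
    the doublings. *)
Let a := B e1 e1 / 2%:R.
Let b := B e2 e2 / 2%:R.
Let c := B e3 e3 / 2%:R.

Let BC u v : B u v = B v u.
Proof. by rewrite hermC /= expr0 mul1r. Qed.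

Let BZZ x y u v : B (x *: u) (y *: v) = x * (y * B u v).
Proof. by rewrite linearZlr. Qed.

Let BE u v :
  B u v = (a * k1 u * k1 v + b * k2 u * k2 v + c * k3 u * k3 v) *+ 2.
Proof.
rewrite {1}(kE u) {1}(kE v) !(linearDl, linearD) /= !BZZ.
rewrite !(BC e2 e1, BC e3 e1, BC e3 e2) B12 B13 B23 /a /b /c.
by field.
Qed.

(** In an orthogonal basis, x lies in the radical exactly when each ki(x) B(ei, ei) is zero. *)
Lemma orthogonal_degenerate :
  ~~ nondegenerate B <-> a = 0 \/ b = 0 \/ c = 0.
Proof.
have div2 x : x / 2%:R = 0 :> F <-> x = 0.
  split=> [/eqP|->]; last by rewrite mul0r.
  by rewrite mulf_eq0 invr_eq0 (negbTE n2) orbF => /eqP.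
rewrite degenerate_formP !div2; split=> [[x x0 Bx]|].
  apply: contrapT => /not_orP[/eqP B1 /not_orP[/eqP B2 /eqP B3]]; apply: x0.
  have Bxl y : B x y = k1 x * B e1 y + k2 x * B e2 y + k3 x * B e3 y.
    by rewrite {1}(kE x) -[y in LHS]scale1r !linearDl /= !BZZ !mul1r.
  have := Bx e1; have := Bx e2; have := Bx e3; rewrite !Bxl.
  rewrite !(BC e2 e1, BC e3 e1, BC e3 e2) B12 B13 B23 !mulr0 !(addr0, add0r).
  move=> /eqP x3 /eqP x2 /eqP x1; move: x1 x2 x3; rewrite !mulf_eq0.
  rewrite (negbTE B1) (negbTE B2) (negbTE B3) !orbF => /eqP x1 /eqP x2 /eqP x3.
  by rewrite (kE x) x1 x2 x3 !scale0r !addr0.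
have e_neq0 (k : V -> F^o) (e : V) : linear k -> k e = 1 -> e <> 0.
  by move=> kL ke e0; have := oner_neq0 F; rewrite -ke e0 (linearf0 kL) eqxx.
have radE e : B e e1 = 0 -> B e e2 = 0 -> B e e3 = 0 -> forall v, B e v = 0.
  move=> h1 h2 h3 v; rewrite {1}(kE v) !linearD /= -[e]scale1r !BZZ h1 h2 h3.
  by rewrite !mulr0 !addr0.
case=> [B11|[B22|B33]].
- by exists e1; [apply: e_neq0 k11|apply: radE].
- by exists e2; [apply: e_neq0 k22|apply: radE; rewrite // BC].
- by exists e3; [apply: e_neq0 k33|apply: radE; rewrite // BC].
Qed.

Let K : nalgType F := kingdon B.
Let iota (v : V) : K := quot_pi (kingdon_rel B) (alt_in v).

Let altK : alternative K.
Proof. exact/quot_alternative/alt_alg_alternative. Qed.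

Let iotaL : linear iota.
Proof.
have [piL _ _] := quot_pi_hom (kingdon_rel B).
by move=> k u v; rewrite /iota alt_in_linear piL.
Qed.

Let iotaC u v : iota u ** iota v + iota v ** iota u = B u v *: 1%g.
Proof.
have [piL pi1 piM] := quot_pi_hom (kingdon_rel B).
apply/eqP; rewrite -subr_eq0 -pi1 -(piM (alt_in u)) -(piM (alt_in v)).
rewrite -(linearfD piL) -(linearfZ _ piL) -(linearfN piL) -(linearfD piL).
by apply/eqP/quot_pi0; left; exists u, v.
Qed.

Let iota_rev u v w : (iota u ** iota v) ** iota w = iota w ** (iota v ** iota u).
Proof.
have [piL pi1 piM] := quot_pi_hom (kingdon_rel B).
apply/eqP; rewrite -subr_eq0 -(piM (alt_in u)) -(piM (alt_in v)).
rewrite -(piM _ (alt_in w)) -(piM (alt_in w)) -(linearfN piL) -(linearfD piL).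
by apply/eqP/quot_pi0; right; exists u, v, w.
Qed.

Let iotaxx v : iota v ** iota v = (B v v / 2%:R) *: 1%g.
Proof.
have := iotaC v v; rewrite -mulr2n -scaler_nat => h.
by rewrite mulrC -scalerA -h scalerA mulVf ?scale1r.
Qed.

Let iota_anti u v : B u v = 0 -> iota u ** iota v = - (iota v ** iota u).
Proof.
by move=> uv; apply/eqP; rewrite -subr_eq0 opprK iotaC uv scale0r.
Qed.

Let vec (v : V) : octonion a b c := pure_octonion a b c (k1 v) (k2 v) (k3 v).

Let vecL : linear vec.
Proof.
move=> k u v; rewrite /vec /pure_octonion k1L k2L k3L.
do 3?[apply: injective_projections => /=]; by rewrite ?scaler0 ?addr0.
Qed.

(** The map [phi] is built layer by layer, sending the adjoined elements to the images of e1, e2 and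
    e3. *)
Let phi1 := cd_ext (c := a) (sqD := base_symmetric_quadratic F)
  (fun x : base_alg F => (x : F) *: (1%g : K)) (iota e1).
Let phi2 := cd_ext (c := b) (sqD := cd1_sq a) phi1 (iota e2).
Let phi : octonion a b c -> K := cd_ext phi2 (iota e3).

Let phi1_hom : nalg_hom phi1.
Proof.
apply: cd_ext_hom => // [|x]; first exact: base_hom.
by rewrite nmulZl nmulZr mul1g mulg1.
Qed.

(** Conjugation negates the e1 coordinate, and [iota v] anticommutes with [iota e1]. Used for v = e2
    and v = e3. *)
Let phi1_anti x v : B e1 v = 0 -> phi1 x ** iota v = iota v ** phi1 (cd_star x).
Proof.
move=> e1v; rewrite /phi1 /cd_ext /= nmulDl nmulDr !nmulZl !mul1g !nmulZr mulg1.
by rewrite (iota_anti e1v) scaleNr scalerN.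
Qed.

Let phi2_hom : nalg_hom phi2.
Proof.
by apply: cd_ext_hom => // x; apply: phi1_anti.
Qed.

(** Here the relations (uv)w = w(vu) enter: anticommutativity of the generators alone would not make
    e1 e2 anticommute with e3. *)
Let iota_rev12 :
  (iota e1 ** iota e2) ** iota e3 = - (iota e3 ** (iota e1 ** iota e2)).
Proof. by rewrite (iota_anti B12) nmulNr opprK -iota_rev (iota_anti B12) nmulNl. Qed.

Let phi1_rev x :
  (phi1 x ** iota e2) ** iota e3 = - (iota e3 ** (phi1 x ** iota e2)).
Proof.
rewrite /phi1 /cd_ext !nmulDl !nmulZl !mul1g.
rewrite (iota_anti B23) iota_rev12 nmulDr !nmulZr.
by rewrite opprD !scalerN.
Qed.

Let phi_hom : nalg_hom phi.
Proof.
apply: cd_ext_hom; [exact: altK|exact: phi2_hom|exact: iotaxx|case=> x y].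
have phi2E u v : phi2 (u, v) = phi1 u + phi1 v ** iota e2 by [].
have phi1N : phi1 (- y) = - phi1 y by case: phi1_hom => h _ _; apply: linearfN h _.
transitivity (iota e3 ** phi2 (cd_star x, - y)); last by [].
rewrite !phi2E nmulDl nmulDr (phi1_anti _ B13) phi1N phi1_rev.
by rewrite nmulNl nmulNr.
Qed.

Let phi_vec v : phi (vec v) = iota v.
Proof.
rewrite /phi /phi2 /phi1 /cd_ext /= !scale0r !nmul0l !addr0 !add0r !nmul0l !addr0.
rewrite !nmulZl !mul1g [in RHS](kE v).
by rewrite !(linearfD iotaL) !(linearfZ _ iotaL).
Qed.

(** The map back, [psi], is induced from [vec] by the universal properties of Alt[V] and of the
    quotient. *)
Lemma kingdon_octonion :
  exists (f : octonion a b c -> kingdon B) (g : kingdon B -> octonion a b c),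
    [/\ nalg_hom f, cancel f g & cancel g f].
Proof.
have altO := octonion_alternative a b c.
have [h [[hH hv] _]] := alt_universal altO vecL.
(* The pure octonions satisfy both families of defining relations. *)
have [|psi psiH psiE] := quot_universal (S := kingdon_rel B) hH.
  case: hH => hL h1 hM x [[u [v ->]]|[u [v [w ->]]]].
    rewrite (linearfD hL) (linearfN hL) (linearfD hL) (linearfZ _ hL) !hM !hv h1.
    by rewrite pure_octonion_mulC BE subrr.
  rewrite (linearfD hL) (linearfN hL) !hM !hv pure_octonion_rev subrr //.
have psi_iota v : psi (iota v) = vec v by rewrite /iota psiE hv.
exists phi, psi; split; first exact: phi_hom.
(* Peel off the three doublings, down to F. *)
- apply: (cd_ext_unique psiH (h := id)) => // [x|]; last first.
    by rewrite psi_iota /vec k13 k23 k33.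
  apply: (cd_ext_unique psiH (cd_in_hom _ _)) => [{}x|]; last first.
    by rewrite psi_iota /vec k12 k22 k32.
  apply: (cd_ext_unique psiH (nalg_hom_comp (cd_in_hom _ _) (cd_in_hom _ _)))
    => [{}x|]; last by rewrite psi_iota /vec k11 k21 k31.
  case: psiH => psiL psi1 _; rewrite (linearfZ _ psiL) psi1.
  do 3?[apply: injective_projections => /=]; rewrite ?scaler0 //.
  exact: mulr1.
(* The quotient map and its composite with [psi] and [phi] both extend [iota] to Alt[V], so they
   coincide. *)
- have [g [_ gU]] := alt_universal altK iotaL.
  have piH := quot_pi_hom (kingdon_rel B).
  have E1 := gU _ (conj piH (fun v => erefl _)).
  have E2 := gU (phi \o (psi \o quot_pi (kingdon_rel B))).
  elim/quot_ind => x; transitivity (g x); last by rewrite E1.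
  rewrite E2 //; split=> [|v].
    exact: nalg_hom_comp (nalg_hom_comp piH psiH) phi_hom.
  by rewrite /= psi_iota phi_vec.
Qed.

End KingdonOctonion.

(** * Degeneracy and simplicity transferred to K(V, B) *)

(** As the norm is unique, (a) can be stated for every symmetric quadratic structure; the existence
    clause keeps it from being vacuous. *)
Theorem corollary4p12 (F : fieldType) (V : vectType F) (B : {symmetric V})
    (two_unit : (2%:R : F) \is a GRing.unit) (dimV : \dim {:V} = 3%N) :
  (exists star T N, symmetric_quadratic (kingdon B) star T N) /\
  (forall star T N, symmetric_quadratic (kingdon B) star T N ->
     (~~ nondegenerate B <-> degenerate_form (polar N))) /\
  (has_dim (kingdon B) 8 /\
   (simple_alg (kingdon B) <-> nondegenerate B)).
Proof.
have n2 : (2%:R : F) != 0 by rewrite -unitfE.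
have [e1 [e2 [e3 [k1 [k2 [k3 [[k1L k2L k3L] [B12 B13 B23] kE
  [[k11 k12 k13] [k21 k22 k23] [k31 k32 k33]]]]]]]]] := orthogonal_basis3 B n2 dimV.
have degB := orthogonal_degenerate n2 k1L k2L k3L B12 B13 B23 kE k11 k22 k33.
have [f [g [fH fK gK]]] := kingdon_octonion n2 k1L k2L k3L B12 B13 B23 kE
  k11 k12 k13 k21 k22 k23 k31 k32 k33.
have sqK := iso_symmetric_quadratic fH fK gK (octonion_sq _ _ _).
split; first by do 3!eexists; exact: sqK.
split=> [star T N sqN|].
  (* Any norm on K(V, B) is the octonion norm transported by [g]. *)
  have -> : N = @octonion_norm _ _ _ _ \o g by apply/funext/(sq_norm_unique sqN sqK).
  by rewrite (iso_degenerate fH fK gK) octonion_degenerate.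
split; first exact: iso_has_dim fH fK gK _ (octonion_has_dim _ _ _).
transitivity (simple_alg (octonion (B e1 e1 / 2%:R) (B e2 e2 / 2%:R)
  (B e3 e3 / 2%:R))).
  split; last exact: iso_simple fH fK gK.
  by apply: iso_simple (nalg_hom_can fH fK gK) gK fK.
rewrite octonion_simple // -degB; split=> [ndB|->//].
exact/negPn/negP.
Qed.
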